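(* For every subsemiheap $K$ of the extended bicyclic semigroup $E$, the W*-TRO $\mathrm{VNTRO}(K)$ generated by $\pi(K)$, where $\pi$ is the left regular representation of $E$ on $\ell^2(E)$, is an injective operator space.
   Context: For $i,j\in\mathbb{Z}$ let $e_{ij}$ be the matrix unit over $\mathbb{Z}$ with $1$ in position $(i,j)$, and let $a_{ij}=\sum_{k\ge0}e_{i+k,j+k}\in B(\ell^2(\mathbb{Z}))$, a partial isometry. The extended bicyclic semigroup is $E=\{a_{ij}:i,j\in\mathbb{Z}\}$ (distinct pairs give distinct elements) with operator multiplication, which satisfies $a_{ij}a_{pq}=a_{i+p-\min(j,p),\,j+q-\min(j,p)}$ and $a_{ij}^*=a_{ji}$; it is an inverse semigroup. A subsemiheap of $E$ is a subset $K\subset E$ such that $ab^*c\in K$ for all $a,b,c\in K$. The left regular representation $\pi$ of $E$ acts on $\ell^2(E)$, which has $E$ as an orthonormal basis, by partial isometries $\pi(x)$ given by $\pi(x)y=xy$ if $yy^*\le x^*x$ (natural order on idempotents: $e\le f$ iff $ef=e$) and $\pi(x)y=0$ otherwise; explicitly, $\pi(a_{ij})a_{pq}=a_{i+p-j,q}$ if $p\ge j$ and $0$ otherwise. $\mathrm{TRO}(K)$ is the ternary ring of operators generated by $\pi(K)$, namely the norm closure of $\mathrm{span}\,\pi(K)$ in $B(\ell^2(E))$ (a ternary ring of operators, TRO, is a norm closed space of operators closed under $(X,Y,Z)\mapsto XY^*Z$; a W*-TRO is a weakly closed one). $\mathrm{VNTRO}(K)$ is the weak closure of $\mathrm{TRO}(K)$.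 An operator space in $B(H)$ is injective if it is the range of a completely contractive projection on $B(H)$ (equivalently, it is injective in the category of operator spaces and complete contractions). *)

(* Defs.v *)
From HB Require Import structures.
From mathcomp Require Import all_boot all_order all_algebra.
From mathcomp Require Import complex zify ring.
From mathcomp Require Import all_classical all_reals ereal esum numfun.

Set Implicit Arguments.
Unset Strict Implicit.
Unset Printing Implicit Defensive.

Import Order.TTheory GRing.Theory Num.Theory.

Local Open Scope classical_set_scope.
Local Open Scope ring_scope.
Local Open Scope complex_scope.

Section Ell2.
Context {R : realType}.

Definition sqmod (z : R[i]) : R := complex.Re z ^+ 2 + complex.Im z ^+ 2.

Lemma sqmod_ge0 z : 0 <= sqmod z.
Proof. by rewrite addr_ge0 ?sqr_ge0. Qed.

Lemma sqmod0 : sqmod 0 = 0.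
Proof. by rewrite /sqmod /= expr0n addr0. Qed.

Lemma sqmodM a b : sqmod (a * b) = sqmod a * sqmod b.
Proof. by case: a b => [a1 a2] [b1 b2]; rewrite /sqmod /=; ring. Qed.

Lemma sqmodD a b : sqmod (a + b) <= 2 * sqmod a + 2 * sqmod b.
Proof.
case: a b => [a1 a2] [b1 b2]; rewrite /sqmod /= -subr_ge0.
have -> : 2 * (a1 ^+ 2 + a2 ^+ 2) + 2 * (b1 ^+ 2 + b2 ^+ 2)
    - ((a1 + b1) ^+ 2 + (a2 + b2) ^+ 2) = (a1 - b1) ^+ 2 + (a2 - b2) ^+ 2 by ring.
by rewrite addr_ge0 ?sqr_ge0.
Qed.

Variable I : choiceType.
Implicit Types f g : I -> R[i]^o.

Definition sqsum f : \bar R := \esum_(i in [set: I]) (sqmod (f i))%:E.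

Lemma sqsum_ge0 f : (0 <= sqsum f)%E.
Proof. by apply: esum_ge0 => i _; rewrite lee_fin sqmod_ge0. Qed.

Lemma sqsum0 : sqsum 0 = 0%E.
Proof. by apply: esum1 => i _; rewrite sqmod0. Qed.

Lemma esumZ_le (c : R) (a : I -> \bar R) : 0 <= c -> (forall i, 0 <= a i)%E ->
  (\esum_(i in [set: I]) (c%:E * a i) <= c%:E * \esum_(i in [set: I]) a i)%E.
Proof.
move=> c0 a0; apply: ge_ereal_sup => _ [X [finX _] <-].
rewrite -ge0_mule_fsumr//; apply: lee_wpmul2l; first by rewrite lee_fin.
by apply: esum_ge; exists X.
Qed.

Lemma sqsumZ c f : (sqsum (c *: f)%R <= (sqmod c)%:E * sqsum f)%E.
Proof.
apply: le_trans (esumZ_le (sqmod_ge0 c) _); last first.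
  by move=> i; rewrite lee_fin sqmod_ge0.
by apply: le_esum => i _; rewrite -EFinM -sqmodM.
Qed.

Lemma sqsumD f g : (sqsum (f + g)%R <= 2%:E * sqsum f + 2%:E * sqsum g)%E.
Proof.
have p (h : I -> R[i]) i : (0 <= (sqmod (h i))%:E :> \bar R)%E by rewrite lee_fin sqmod_ge0.
have le2 (h : I -> R[i]) := esumZ_le (ler0n R 2) (p h).
apply: le_trans (leeD (le2 f) (le2 g)).
rewrite -esumD; try by move=> i _; rewrite mule_ge0 ?lee_fin ?sqmod_ge0.
by apply: le_esum => i _; rewrite -!EFinM -EFinD lee_fin sqmodD.
Qed.

Definition square_summable : {pred (I -> R[i]^o)} :=
  fun f => (sqsum f < +oo)%E.

Lemma square_summable_submod_closed : submod_closed square_summable.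
Proof.
split; first by rewrite unfold_in sqsum0 ltry.
move=> c f g; rewrite !unfold_in => fs gs.
apply: le_lt_trans (sqsumD _ _) _; apply: lte_add_pinfty; last first.
  by rewrite lte_mul_pinfty ?lee_fin.
rewrite lte_mul_pinfty ?lee_fin//; apply: le_lt_trans (sqsumZ _ _) _.
by rewrite lte_mul_pinfty ?lee_fin ?sqmod_ge0.
Qed.

HB.instance Definition _ := GRing.isSubmodClosed.Build R[i] (I -> R[i]^o)
  square_summable square_summable_submod_closed.

Record ell2 := Ell2 { ell2_val :> I -> R[i]^o; ell2P : ell2_val \in square_summable }.

HB.instance Definition _ := [isSub for ell2_val].
HB.instance Definition _ := [Choice of ell2 by <:].
HB.instance Definition _ := [SubChoice_isSubLmodule of ell2 by <:].
End Ell2.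
Arguments ell2 R I : clear implicits.

Section Hilbert.
Context {R : realType} {I : choiceType}.
Implicit Types x y : ell2 R I.

Lemma ell2_eqP x y : (forall i, x i = y i) -> x = y.
Proof. by move=> xy; apply: val_inj; apply/funext. Qed.

Definition norm2 x : R := Num.sqrt (fine (sqsum x)).

Lemma norm2_ge0 x : 0 <= norm2 x.
Proof. exact: sqrtr_ge0. Qed.

Lemma sqsumE x : sqsum x = ((norm2 x) ^+ 2)%:E.
Proof.
have xoo : (sqsum x < +oo)%E := ell2P x.
rewrite sqr_sqrtr ?fine_ge0 ?sqsum_ge0// fineK//.
by rewrite ge0_fin_numE// sqsum_ge0.
Qed.

Lemma norm2_le x y : (sqsum x <= sqsum y)%E -> norm2 x <= norm2 y.
Proof.
rewrite !sqsumE lee_fin => xy.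
by rewrite -(@ler_pXn2r _ 2) ?nnegrE ?norm2_ge0.
Qed.

(* An unconditional sum, meaningful when a is absolutely summable. *)
Definition rsum (a : I -> R) : R :=
  fine (\esum_(i in [set: I]) (a^\+ i)%:E) - fine (\esum_(i in [set: I]) (a^\- i)%:E).

Definition inner x y : R[i] :=
  rsum (fun i => complex.Re (x i * (y i)^*)) +i*
  rsum (fun i => complex.Im (x i * (y i)^*)).

Lemma inner_norm2 x : inner x x = (norm2 x ^+ 2)%:C.
Proof.
have E i : x i * (x i)^* = (sqmod (x i))%:C.
  case: (x i) => u v; rewrite /sqmod /=.
  by apply/eqP; rewrite eq_complex /=; apply/andP; split; apply/eqP; ring.
have e0 (a : I -> R) : (forall i, a i = 0) -> fine (\esum_(i in [set: I]) (a i)%:E) = 0.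
  by move=> a0; rewrite esum1// => i _; rewrite a0.
apply/eqP; rewrite eq_complex /inner /rsum /=; apply/andP; split; apply/eqP.
  rewrite [X in _ - X]e0 => [|i]; last first.
    by rewrite /funrneg E /= max_r// oppr_le0 sqmod_ge0.
  rewrite subr0 sqr_sqrtr ?fine_ge0 ?sqsum_ge0//; congr fine; apply: eq_esum => i _.
  by rewrite /funrpos E /= max_l// sqmod_ge0.
by rewrite !e0 ?subrr// => i; rewrite /funrpos /funrneg E /= ?oppr0 maxxx.
Qed.

Lemma delta_subproof i :
  (fun j => (j == i)%:R : R[i]^o) \in @square_summable R I.
Proof.
rewrite unfold_in; have -> : sqsum (fun j => (j == i)%:R : R[i]^o) =
    \esum_(j in [set: I] `&` [set i]) 1%:E.
  rewrite [in RHS]esum_mkcondr; apply: eq_esum => j _.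
  have [->|/eqP ji] := eqVneq j i; last by rewrite memNset// sqmod0.
  by rewrite mem_set// /sqmod /= expr1n expr0n addr0.
by rewrite setTI esum_set1 ?ltry// lee_fin.
Qed.

Definition delta i : ell2 R I := Ell2 (delta_subproof i).

End Hilbert.

Section BoundedOperators.
Context {R : realType} {I : choiceType}.
Local Notation H := (ell2 R I).

Definition bounded_linear : {pred (H -> H)} := fun T =>
  `[< linear T /\ exists M : R, forall x, norm2 (T x) <= M * norm2 x >].

Lemma norm2D (x y : H) : norm2 (x + y) <= 2 * norm2 x + 2 * norm2 y.
Proof.
have x0 := norm2_ge0 x; have y0 := norm2_ge0 y; have z0 := norm2_ge0 (x + y).
have := sqsumD x y; rewrite -[X in sqsum X]/(ell2_val (x + y)) !sqsumE.
rewrite -!EFinM -EFinD lee_fin => h.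
rewrite -(@ler_pXn2r _ 2) ?nnegrE ?addr_ge0 ?mulr_ge0//.
apply: le_trans h _; rewrite -subr_ge0.
have -> : (2 * norm2 x + 2 * norm2 y) ^+ 2 - (2 * norm2 x ^+ 2 + 2 * norm2 y ^+ 2)
  = 2 * norm2 x ^+ 2 + 2 * norm2 y ^+ 2 + 8 * (norm2 x * norm2 y) by ring.
by rewrite !addr_ge0 ?mulr_ge0 ?sqr_ge0.
Qed.

Lemma norm2Z c (x : H) : norm2 (c *: x) <= Num.sqrt (sqmod c) * norm2 x.
Proof.
have := sqsumZ c x; rewrite -[X in sqsum X]/(ell2_val (c *: x)) !sqsumE.
rewrite -!EFinM lee_fin => h.
rewrite -(@ler_pXn2r _ 2) ?nnegrE ?mulr_ge0 ?norm2_ge0 ?sqrtr_ge0//.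
by rewrite exprMn (sqr_sqrtr (sqmod_ge0 c)).
Qed.

Lemma norm20 : norm2 (0 : H) = 0.
Proof. by rewrite /norm2 sqsum0 sqrtr0. Qed.

Lemma bounded_linear_submod_closed : submod_closed bounded_linear.
Proof.
split.
  apply/asboolP; split=> [a x y|]; first by rewrite /= scaler0 addr0.
  by exists 0 => x; rewrite norm20 mul0r.
move=> c S T /asboolP[Sl [M SM]] /asboolP[Tl [N TN]]; apply/asboolP; split.
  move=> a x y; rewrite !fctE Sl Tl !scalerDr !scalerA mulrC addrACA.
  by rewrite mulrC.
exists (2 * (Num.sqrt (sqmod c) * M) + 2 * N) => x.
apply: le_trans (norm2D _ _) _; rewrite [leRHS]mulrDl lerD//; last first.
  by rewrite -[leRHS]mulrA ler_wpM2l.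
rewrite -[leRHS]mulrA ler_wpM2l//; apply: le_trans (norm2Z _ _) _.
by rewrite -[leRHS]mulrA ler_wpM2l ?sqrtr_ge0.
Qed.

HB.instance Definition _ := GRing.isSubmodClosed.Build R[i] (H -> H)
  bounded_linear bounded_linear_submod_closed.

Record bop := Bop { bop_val :> H -> H ; bopP : bop_val \in bounded_linear }.

HB.instance Definition _ := [isSub for bop_val].
HB.instance Definition _ := [Choice of bop by <:].
HB.instance Definition _ := [SubChoice_isSubLmodule of bop by <:].

Implicit Types (A : set bop) (S T : bop).

Definition opnorm T : R := sup [set norm2 (T x) | x in [set x | norm2 x <= 1]].

Definition norm_closure A : set bop :=
  [set T | forall e : R, 0 < e -> exists2 S, A S & opnorm (T - S) < e].

(* Closure in the weak operator topology. *)
Definition weak_closure A : set bop :=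
  [set T | forall (n : nat) (x y : 'I_n -> H) (e : R), 0 < e ->
    exists2 S, A S & forall k, `|inner ((T - S) (x k)) (y k)| < e%:C].

Definition linear_span A : set bop :=
  [set T | exists (n : nat) (c : 'I_n -> R[i]) (S : 'I_n -> bop),
    (forall k, A (S k)) /\ T = \sum_k c k *: S k].

Definition tuple_norm2 n (x : 'I_n -> H) : R := Num.sqrt (\sum_i norm2 (x i) ^+ 2).

(* The norm of a matrix of operators, acting on the n-fold direct sum of H. *)
Definition opmx_norm n (T : 'M[bop]_n) : R :=
  sup [set tuple_norm2 (fun i => \sum_j T i j (x j)) |
       x in [set x : 'I_n -> H | tuple_norm2 x <= 1]].

Definition completely_contractive (P : bop -> bop) : Prop :=
  forall n (T : 'M[bop]_n), opmx_norm (map_mx P T) <= opmx_norm T.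

Definition injective_operator_space (V : set bop) : Prop :=
  exists P : {linear bop -> bop},
    [/\ forall T, P (P T) = P T, completely_contractive P & range P = V].

End BoundedOperators.
Arguments bop R I : clear implicits.

Section PartialIsometry.
Context {R : realType} {I : choiceType}.
Variable g : I -> option I.
Hypothesis g_inj : forall i j k, g i = Some k -> g j = Some k -> i = j.

Definition pullback (x : I -> R[i]^o) : I -> R[i]^o :=
  fun i => if g i is Some j then x j else 0.

Lemma sqsum_pullback x : (sqsum (pullback x) <= sqsum x)%E.
Proof.
pose D := [set i | isSome (g i)]; pose h i := odflt i (g i).
have hinj : set_inj D h.
  move=> i j; rewrite !inE /D /h /=.
  case gi: (g i) => [k|//] _; case gj: (g j) => [l|//] _ /= kl.
  by apply: (g_inj gi); rewrite gj kl.
have -> : sqsum (pullback x) = \esum_(i in D) (sqmod (x (h i)))%:E.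
  rewrite esum_mkcond; apply: eq_esum => i _; rewrite /pullback /h.
  case: ifPn; rewrite ?inE ?notin_setE /D /=; case: (g i) => [j|] //= _.
  by rewrite sqmod0.
rewrite -(@esum_image _ _ _ D h (fun j => (sqmod (x j))%:E))// esum_mkcond.
by apply: le_esum => i _; case: ifP; rewrite lee_fin ?sqmod_ge0.
Qed.

Lemma pullback_subproof (x : ell2 R I) : pullback x \in @square_summable R I.
Proof.
by rewrite unfold_in; apply: le_lt_trans (sqsum_pullback x) _; exact: (ell2P x).
Qed.

Lemma pullback_bounded :
  (fun x => Ell2 (pullback_subproof x)) \in @bounded_linear R I.
Proof.
apply/asboolP; split=> [c x y|].
  apply: ell2_eqP => i; rewrite -[RHS]/(c *: pullback x i + pullback y i).
  by rewrite /= /pullback; case: (g i) => //; rewrite scaler0 addr0.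
exists 1 => x; rewrite mul1r; apply: norm2_le; exact: sqsum_pullback.
Qed.

(* The partial isometry mapping delta j to delta i when g i = Some j, and to 0
   when there is no such i. *)
Definition partial_isometry : bop R I := Bop pullback_bounded.

End PartialIsometry.

Section Adjoint.
Context {R : realType} {I : choiceType}.
Variables g g' : I -> option I.
Hypothesis g_inj : forall i j k, g i = Some k -> g j = Some k -> i = j.
Hypothesis g'_inj : forall i j k, g' i = Some k -> g' j = Some k -> i = j.
Hypothesis gg' : forall i j, g i = Some j <-> g' j = Some i.

Lemma esum_pullback (phi : R[i] -> R[i] -> R) (x y : I -> R[i]^o) :
  (forall u, phi u 0 = 0) -> (forall v, phi 0 v = 0) ->
  \esum_(i in [set: I]) (phi (pullback g x i) (y i))%:E =
  \esum_(j in [set: I]) (phi (x j) (pullback g' y j))%:E.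
Proof.
move=> phi0 phi0'; pose D := [set i | isSome (g i)]; pose D' := [set j | isSome (g' j)].
pose h i := odflt i (g i).
have hbij : set_bij D D' h.
  split=> [i|i j|j]; rewrite ?inE /D /D' /h /=.
  - by case gi: (g i) => [k|//] _ /=; have /gg' -> := gi.
  - case gi: (g i) => [k|//] _; case gj: (g j) => [l|//] _ /= kl.
    by apply: (g_inj gi); rewrite gj kl.
  - case gj: (g' j) => [i|//] _; have /gg' gi := gj.
    by exists i; rewrite ?gi.
transitivity (\esum_(j in D') (phi (x j) (pullback g' y j))%:E).
  rewrite (reindex_esum D D' h)//; last first.
  rewrite [RHS]esum_mkcond; apply: eq_esum => i _; rewrite /pullback /h.
  case: ifPn; rewrite ?inE ?notin_setE /D /=.
    by case gi: (g i) => [j|//] _ /=; have /gg' -> := gi.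
  by case: (g i) => // _; rewrite phi0'.
rewrite esum_mkcond; apply: eq_esum => j _; rewrite /pullback.
case: ifPn; rewrite ?inE ?notin_setE /D' //=.
by case: (g' j) => // _; rewrite phi0.
Qed.

Lemma inner_partial_isometry (x y : ell2 R I) :
  inner (partial_isometry g_inj x) y = inner x (partial_isometry g'_inj y).
Proof.
rewrite /inner /rsum /funrpos /funrneg /=; congr (_ +i* _); congr (fine _ - fine _).
- by apply: (esum_pullback (phi := fun u v => Num.max (complex.Re (u * v^*)) 0)) => u;
    rewrite ?rmorph0 ?mulr0 ?mul0r /= maxxx.
- by apply: (esum_pullback (phi := fun u v => Num.max (- complex.Re (u * v^*)) 0)) => u;
    rewrite ?rmorph0 ?mulr0 ?mul0r /= ?oppr0 maxxx.
- by apply: (esum_pullback (phi := fun u v => Num.max (complex.Im (u * v^*)) 0)) => u;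
    rewrite ?rmorph0 ?mulr0 ?mul0r /= maxxx.
- by apply: (esum_pullback (phi := fun u v => Num.max (- complex.Im (u * v^*)) 0)) => u;
    rewrite ?rmorph0 ?mulr0 ?mul0r /= ?oppr0 maxxx.
Qed.

End Adjoint.

(* The pair (i, j) stands for the partial isometry a_ij of l^2(Z), which maps
   e_(j + k) to e_(i + k) for k >= 0 and is zero on the other basis vectors;
   see ebs_op below. *)
Definition ebs : Type := (int * int)%type.
HB.instance Definition _ := Choice.copy ebs (int * int)%type.

Implicit Types a b : ebs.

Definition ebs_mul a b : ebs :=
  (a.1 + b.1 - Num.min a.2 b.1, a.2 + b.2 - Num.min a.2 b.1).

Definition ebs_star a : ebs := (a.2, a.1).

Definition subsemiheap (K : set ebs) : Prop :=
  forall a b c, K a -> K b -> K c -> K (ebs_mul (ebs_mul a (ebs_star b)) c).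

Definition idem_le (e f : ebs) : bool := ebs_mul e f == e.

Lemma ebs_mulA : associative ebs_mul.
Proof.
by move=> [a a'] [b b'] [c c']; rewrite /ebs_mul /=; congr pair; lia.
Qed.

Lemma ebs_starM a b : ebs_star (ebs_mul a b) = ebs_mul (ebs_star b) (ebs_star a).
Proof.
by move: a b => [a a'] [b b']; rewrite /ebs_mul /ebs_star /=; congr pair; lia.
Qed.

Lemma ebs_star_inv a : ebs_mul (ebs_mul a (ebs_star a)) a = a.
Proof. by case: a => a a'; rewrite /ebs_mul /ebs_star /=; congr pair; lia. Qed.

Section Realization.
Context (R : realType).

Definition ebs_back a (m : int) : option int :=
  if a.1 <= m then Some (a.2 + (m - a.1)) else None.

Lemma ebs_back_inj a m n k : ebs_back a m = Some k -> ebs_back a n = Some k -> m = n.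
Proof.
rewrite /ebs_back; case: ifP => // _ [<-]; case: ifP => // _ [].
by move=> /addrI/addIr.
Qed.

Definition ebs_op a : bop R int := partial_isometry (@ebs_back_inj a).

Lemma ebs_op_delta a (n : int) : ebs_op a (delta n) =
  if a.2 <= n then delta (a.1 + (n - a.2)) else 0.
Proof.
apply: ell2_eqP => m; rewrite /= /pullback /ebs_back /=.
case: (leP a.1 m) => am; case: (leP a.2 n) => an //=; last first.
- by case: eqP => // E; exfalso; move: E am an; lia.
- by case: eqP => // E; exfalso; move: E am an; lia.
by congr (_%:R); congr nat_of_bool; apply/eqP/eqP; lia.
Qed.

Lemma ebs_op_mul a b x : ebs_op (ebs_mul a b) x = ebs_op a (ebs_op b x).
Proof.
apply: ell2_eqP => m; move: a b => [a a'] [b b'].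
rewrite /= /pullback /ebs_back /ebs_mul /=.
case: (leP a m) => am.
  by case: leP => h1; case: leP => h2 //; [congr (x _)|exfalso|exfalso]; lia.
by case: leP => // h1; exfalso; lia.
Qed.

Lemma ebs_op_inj : injective ebs_op.
Proof.
suff le a b : ebs_op a = ebs_op b -> b.2 <= a.2 /\ a.1 = b.1 + (a.2 - b.2).
  move=> a b ab; have [h1 h2] := le _ _ ab; have [h3 _] := le _ _ (esym ab).
  by move: a b h1 h2 h3 {ab} => [a a'] [b b'] /= h1 h2 h3; congr pair; lia.
move=> /(congr1 (fun T : bop R int => T (delta a.2) a.1)).
rewrite !ebs_op_delta lexx subrr addr0 /= eqxx.
case: leP => _ /= => [|/eqP]; last by rewrite oner_eq0.
by case: eqP => // _ /eqP; rewrite oner_eq0.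
Qed.

Lemma ebs_op_star a x y : inner (ebs_op a x) y = inner x (ebs_op (ebs_star a) y).
Proof.
apply: inner_partial_isometry => m n; rewrite /ebs_back /=.
by split; case: leP => // h [<-]; rewrite ifT; try lia; congr Some; lia.
Qed.

End Realization.

Section LeftRegular.
Context (R : realType).

(* lreg a maps xi to the function c |-> xi (a^* c) supported where
   c c^* <= a a^*; lreg_delta is the action on the basis. *)
Definition lreg_back a (c : ebs) : option ebs :=
  if idem_le (ebs_mul c (ebs_star c)) (ebs_mul a (ebs_star a))
  then Some (ebs_mul (ebs_star a) c) else None.

Lemma lreg_backE a c : lreg_back a c =
  if a.1 <= c.1 then Some (a.2 + (c.1 - a.1), c.2) else None.
Proof.
rewrite /lreg_back; move: a c => [a a'] [c c'].
rewrite /idem_le /ebs_mul /ebs_star /= xpair_eqE.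
case: (leP a c) => ac.
  rewrite ifT; first by congr Some; congr pair; lia.
  by apply/andP; split; apply/eqP; lia.
rewrite ifF//; apply/negP => /andP[/eqP h _]; move: h; lia.
Qed.

Lemma lreg_back_inj a b c d :
  lreg_back a b = Some d -> lreg_back a c = Some d -> b = c.
Proof.
rewrite !lreg_backE; case: ifP => // _ [<-]; case: ifP => // _ [].
by move=> /addrI/addIr e1 e2; rewrite [b]surjective_pairing [c]surjective_pairing e1 e2.
Qed.

Definition lreg a : bop R ebs := partial_isometry (@lreg_back_inj a).

Lemma lreg_delta_explicit a b : lreg a (delta b) =
  if a.2 <= b.1 then delta ((a.1 + b.1 - a.2, b.2) : ebs) else 0.
Proof.
apply: ell2_eqP => -[m q]; rewrite /= /pullback lreg_backE.
move: a b => [a a'] [b b'] /=.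
case: (leP a m) => am; case: (leP a' b) => ab //=; rewrite ?xpair_eqE.
- by congr (_%:R); congr nat_of_bool; congr (_ && _); apply/eqP/eqP; lia.
- by case: eqP => //= E; exfalso; lia.
- by case: eqP => //= E; exfalso; lia.
Qed.

Lemma lreg_delta a b : lreg a (delta b) =
  if idem_le (ebs_mul b (ebs_star b)) (ebs_mul (ebs_star a) a)
  then delta (ebs_mul a b) else 0.
Proof.
rewrite lreg_delta_explicit; move: a b => [a a'] [b b'].
rewrite /idem_le /ebs_mul /ebs_star /= xpair_eqE.
case: (leP a' b) => ab.
  rewrite ifT; first by congr delta; congr pair; lia.
  by apply/andP; split; apply/eqP; lia.
rewrite ifF//; apply/negP => /andP[/eqP h _]; move: h; lia.
Qed.

Definition TRO (K : set ebs) : set (bop R ebs) :=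
  norm_closure (linear_span (lreg @` K)).

Definition VNTRO (K : set ebs) : set (bop R ebs) := weak_closure (TRO K).

End LeftRegular.
Arguments TRO R K : clear implicits.
Arguments VNTRO R K : clear implicits.

(* Main.v *)
Require Import Defs.
From HB Require Import structures.
From mathcomp Require Import all_boot all_order all_algebra.
From mathcomp Require Import all_classical all_reals.
From mathcomp Require Import complex zify ring lra ereal esum numfun.

(** On l^2(E) = l^2(Z) (x) l^2(Z) the left regular representation is
    a_ij |-> a_ij (x) 1.  Let I and J be the sets of first and of second
    indices of the elements of K.  The set I cuts Z into blocks, each running
    from an element of I up to the next one (the last block may be infinite,
    and the integers below every element of I lie in no block); so does J.

    The semiheap law says two things about K.  First, K is a disjoint union of
    rectangles I_r x J_r ([semiheap_rect]).  Secondly, if (i, j) is in K, then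
    above i and j the sets I and J are translates of each other by i - j, and
    the translates (i + k, j + k) stay in K ([semiheap_shift_row],
    [semiheap_shift_col]).  Hence for (i, j) in K the translation by i - j
    maps the block of J at j onto the block of I at i; the partial isometry
    w_ij which it induces is a_ij minus its successor a_(i+l)(j+l) of the next
    block, or a_ij itself when the block is infinite.  The w_ij multiply like
    matrix units, and VNTRO(K) is the weakly closed span of the w_ij (x) 1: a
    direct sum, over the rectangles, of copies of B(l^2(J_r), l^2(I_r)), each
    with a multiplicity.

    The projection is therefore explicit: P(T) is the sum over (i, j) in K of
    T_((i,0),(j,0)) w_ij (x) 1, where T_(b,c) are the matrix entries of T; it
    reads T at the starts of the blocks and repeats the result along the
    blocks and along the second tensor factor.  Labelling the repetitions
    (rectangle, position in the block, second coordinate) by the elements a of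
    a set, P(T) is the compression of T (x) 1 by two partial isometries
    delta_b |-> delta_(a,b'), and so P is completely contractive
    ([compress_cc]).  Each coordinate of P(T) x is a coordinate of T x' with x'
    independent of T, so the fixed points of P form a weakly closed space,
    which contains pi(K) ([block_compression_lreg]) and hence VNTRO(K).
    Conversely P(T), cut down to finitely many blocks, is a finite linear
    combination of the w_ij (x) 1 ([block_compression_window]), and these
    truncations converge strongly to P(T) ([block_compression_approx]), so
    P(T) is in VNTRO(K). *)

Set Implicit Arguments.
Unset Strict Implicit.
Unset Printing Implicit Defensive.

Import Order.TTheory GRing.Theory Num.Theory.

Local Open Scope classical_set_scope.
Local Open Scope ring_scope.
Local Open Scope complex_scope.

(** * Compressions of amplified operators *)

Section PartialInjections.
Context {R : realType}.

Definition partial_injection {I J : Type} (g : I -> option J) :=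
  forall i i' j, g i = Some j -> g i' = Some j -> i = i'.

(** Both sides are sums over subsets of [option J], on which [f] is extended
    by 0 at [None]; there [g] is a genuine injection on its domain. *)
Lemma esum_partial_injection {I J : choiceType} (g : I -> option J)
    (f : J -> \bar R) :
  partial_injection g -> (forall j, 0 <= f j)%E ->
  (\esum_(i in [set: I]) (if g i is Some j then f j else 0) <=
   \esum_(j in [set: J]) f j)%E.
Proof.
move=> g_inj f0; pose f' := oapp f 0%E; pose D := [set i | isSome (g i)].
have f'0 o : (0 <= f' o)%E by case: o => /=.
have gD : set_inj D g.
  move=> i i' _; rewrite inE /D /=; case gi': (g i') => [j|//] _ gi.
  exact: (g_inj _ _ _ gi gi').
have -> : \esum_(i in [set: I]) (if g i is Some j then f j else 0%E) =
    \esum_(i in D) f' (g i).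
  rewrite [RHS]esum_mkcond; apply: eq_esum => i _.
  by case: ifPn; rewrite ?inE ?notin_setE /D /=; case: (g i) => [j|] //= _.
rewrite -(esum_image D g f' gD).
rewrite -(esum_image [set: J] Some f'); last by move=> ? ? _ _ [].
rewrite esum_mkcond [leRHS]esum_mkcond; apply: le_esum => o _.
case: ifPn => [|_]; last by case: ifP.
move=> /set_mem[i Di <-]; move: Di; rewrite /D /=; case: (g i) => [j|//] _.
by rewrite mem_set//; exists j.
Qed.
End PartialInjections.

Section Compression.
Context {R : realType} {X A : choiceType}.
Local Notation H := (ell2 R X).
Variables (r : X -> option (A * X)) (s : A * X -> option X).
Hypothesis r_inj : partial_injection r.
Hypothesis s_inj : partial_injection s.

Lemma ell2_sumE {J : Type} (l : seq J) (P : pred J) (y : J -> H) (c : X) :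
  (\sum_(j <- l | P j) y j) c = \sum_(j <- l | P j) (y j) c.
Proof. by elim/big_ind2: _ => // _ u _ v <- <-. Qed.

(** The partial isometry x |-> sum over a of delta_a (x) slice a x, read
    componentwise. *)
Definition slice_fun (a : A) (x : H) : X -> R[i]^o :=
  fun c => if s (a, c) is Some d then x d else 0.

Lemma sum_sqsum_slice (x : H) :
  (\esum_(a in [set: A]) sqsum (slice_fun a x) <= sqsum x)%E.
Proof.
rewrite /sqsum esum_esum; last by move=> *; rewrite lee_fin sqmod_ge0.
have -> : [set: A] `*`` (fun=> [set: X]) = [set: A * X] by apply/seteqP; split.
apply: le_trans (esum_partial_injection (f := fun d => (sqmod (x d))%:E) s_inj _).
  apply: le_esum => -[a c] _; rewrite /slice_fun /=.
  by case: (s (a, c)) => // ; rewrite sqmod0.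
by move=> d; rewrite lee_fin sqmod_ge0.
Qed.

Lemma slice_subproof a x : slice_fun a x \in @square_summable R X.
Proof.
rewrite unfold_in; apply: le_lt_trans (ell2P x).
apply: le_trans (sum_sqsum_slice x).
rewrite -[leLHS](@esum_set1 _ _ a (fun a => sqsum (slice_fun a x))) ?sqsum_ge0//.
rewrite esum_mkcond; apply: le_esum => b _.
by case: ifP => // _; exact: sqsum_ge0.
Qed.

Definition slice a x : H := Ell2 (slice_subproof a x).

Lemma sliceP a c x y : slice a (c *: x + y) = c *: slice a x + slice a y.
Proof.
apply: ell2_eqP => d; rewrite -[RHS]/(c *: slice_fun a x d + slice_fun a y d).
by rewrite /= /slice_fun; case: (s (a, d)) => //; rewrite scaler0 addr0.
Qed.

(** This is L (T (x) 1) R x, where R x has the components [slice a x] and L is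
    the partial isometry mapping delta_(a,c) to delta_b when
    [r b = Some (a, c)]. *)
Definition compress_fun (T : H -> H) (x : H) : X -> R[i]^o :=
  fun b => if r b is Some p then T (slice p.1 x) p.2 else 0.

(** On the slices with a given label a only T acts, so the bound for T applies
    for each a; summing over a costs nothing because r and s
    are injective. *)
Lemma compress_bound n (T : 'I_n -> 'I_n -> H -> H) (N : R) (x : 'I_n -> H) :
  0 <= N ->
  (forall y : 'I_n -> H,
    \sum_i sqsum ((\sum_j T i j (y j))%R : H) <= N%:E * \sum_j sqsum (y j))%E ->
  (\sum_i sqsum (fun b => (\sum_j compress_fun (T i j) (x j) b)%R)
   <= N%:E * \sum_j sqsum (x j))%E.
Proof.
move=> N0 TN.
pose G i a : H := \sum_j T i j (slice a (x j)).
have le_row i : (sqsum (fun b => (\sum_j compress_fun (T i j) (x j) b)%R) <=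
    \esum_(a in [set: A]) sqsum (G i a))%E.
  rewrite {2}/sqsum esum_esum; last by move=> *; rewrite lee_fin sqmod_ge0.
  have -> : [set: A] `*`` (fun=> [set: X]) = [set: A * X] by apply/seteqP; split.
  apply: le_trans
    (esum_partial_injection (f := fun p => (sqmod (G i p.1 p.2))%:E) r_inj _).
    apply: le_esum => b _; rewrite /compress_fun.
    case: (r b) => [p|]; last by rewrite big1// sqmod0.
    by rewrite /G ell2_sumE.
  by move=> p; rewrite lee_fin sqmod_ge0.
apply: le_trans (lee_sum _ (fun i _ => le_row i)) _.
rewrite -esum_sum; last by move=> *; exact: sqsum_ge0.
have le_copy a : (\sum_i sqsum (G i a) <=
    N%:E * \sum_j sqsum (slice_fun a (x j)))%E by exact: (TN (fun j => slice a (x j))).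
apply: le_trans (le_esum (fun a _ => le_copy a)) _.
apply: le_trans (esumZ_le N0 _) _.
  by move=> a; apply: sume_ge0 => j _; exact: sqsum_ge0.
apply: lee_wpmul2l; first by rewrite lee_fin.
rewrite esum_sum; last by move=> *; exact: sqsum_ge0.
by apply: lee_sum => j _; exact: sum_sqsum_slice.
Qed.
End Compression.

(** * Operator norms and matrix norms *)

Section OperatorNorms.
Context {R : realType}.

(** Since q may vanish at a nonzero x, the vector x is divided by a number
    slightly larger than [q x]. *)
Lemma sup_ball_bound {V : lmodType R[i]} (p q : V -> R) (M : R) (x : V) :
  (forall y, 0 <= p y) -> (forall y, 0 <= q y) ->
  (forall (c : R) y, 0 <= c -> p (c%:C *: y) <= c * p y) ->
  (forall (c : R) y, 0 <= c -> q (c%:C *: y) <= c * q y) ->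
  (forall y, q y <= 1 -> p y <= M) ->
  p x <= sup [set p y | y in [set y | q y <= 1]] * q x.
Proof.
move=> p0 q0 pZ qZ pM; set N := sup _.
have leN y : q y <= 1 -> p y <= N.
  move=> y1; apply: ub_le_sup; last by exists y.
  by exists M => _ [z z1 <-]; exact: pM.
have N0 : 0 <= N.
  apply: le_trans (leN 0 _); first exact: p0.
  by rewrite -(scale0r x); apply: le_trans (qZ 0 x _) _; rewrite ?mul0r.
apply/ler_addgt0Pr => e e0.
have N1 : 0 < N + 1 by rewrite ltr_wpDl.
pose t := q x + e / (N + 1).
have t0 : 0 < t by rewrite ltr_wpDl ?q0 ?divr_gt0.
have tx : x = t%:C *: (t^-1%:C *: x).
  by rewrite scalerA -rmorphM/= divff ?gt_eqF// scale1r.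
rewrite {1}tx; apply: le_trans (pZ _ _ (ltW t0)) _.
have : p (t^-1%:C *: x) <= N.
  apply: leN; apply: le_trans (qZ _ _ _) _; first by rewrite invr_ge0 ltW.
  by rewrite mulrC ler_pdivrMr// mul1r lerDl divr_ge0// ltW.
rewrite -(ler_pM2l t0) => /le_trans; apply.
rewrite /t mulrDl mulrC lerD2l -mulrA ger_pMr// mulrC ler_pdivrMr// mul1r.
by rewrite lerDl.
Qed.

Context {I : choiceType}.
Local Notation H := (ell2 R I).
Implicit Types (T : bop R I).

Lemma bop_linear T : linear T.
Proof. by have /asboolP[] := bopP T. Qed.

Lemma bopD T x y : T (x + y) = T x + T y.
Proof. by have := bop_linear T 1 x y; rewrite !scale1r. Qed.

Lemma bop0 T : T 0 = 0.
Proof. by have := bopD T 0 0; rewrite addr0 => /eqP; rewrite addrC -subr_eq subrr => /eqP. Qed.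

Lemma bopZ T c x : T (c *: x) = c *: T x.
Proof. by have := bop_linear T c x 0; rewrite !addr0 bop0 addr0. Qed.

Lemma bopB T x y : T (x - y) = T x - T y.
Proof. by rewrite -scaleN1r bopD bopZ scaleN1r. Qed.

Lemma bop_sum T {J : Type} (l : seq J) (P : pred J) (y : J -> H) :
  T (\sum_(j <- l | P j) y j) = \sum_(j <- l | P j) T (y j).
Proof. by elim/big_rec2: _ => [|j u v _ <-]; rewrite ?bop0 ?bopD. Qed.

Lemma bop_sumE {J : Type} (l : seq J) (P : pred J) (S : J -> bop R I) x :
  (\sum_(j <- l | P j) S j) x = \sum_(j <- l | P j) S j x.
Proof. by elim/big_ind2: _ => // _ u _ v <- <-. Qed.

Lemma bop_bounded T : exists2 M : R, 0 <= M & forall x, norm2 (T x) <= M * norm2 x.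
Proof.
have /asboolP[_ [M TM]] := bopP T; exists `|M| => // x.
by apply: le_trans (TM x) _; rewrite ler_wpM2r ?norm2_ge0 ?ler_norm.
Qed.

Lemma norm2_scale_real (c : R) (x : H) : 0 <= c -> norm2 (c%:C *: x) <= c * norm2 x.
Proof.
move=> c0; apply: le_trans (norm2Z _ _) _.
by rewrite /sqmod /= expr0n addr0 sqrtr_sqr ger0_norm.
Qed.

Lemma opnorm_bound T x : norm2 (T x) <= opnorm T * norm2 x.
Proof.
have [M M0 TM] := bop_bounded T.
apply: (@sup_ball_bound _ (fun x => norm2 (T x)) norm2 M) => //.
- by move=> y; exact: norm2_ge0.
- by move=> y; exact: norm2_ge0.
- by move=> c y c0; rewrite bopZ norm2_scale_real.
- by move=> c y c0; rewrite norm2_scale_real.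
- by move=> y y1; apply: le_trans (TM y) _; rewrite ler_piMr.
Qed.

Lemma sum_sqsumE n (x : 'I_n -> H) :
  (\sum_i sqsum (x i) = (tuple_norm2 x ^+ 2)%:E)%E.
Proof.
rewrite /tuple_norm2 sqr_sqrtr ?sumr_ge0// => [|i _]; last exact: sqr_ge0.
by rewrite -sumEFin; apply: eq_bigr => i _; rewrite sqsumE.
Qed.

Lemma tuple_norm2_ge0 n (x : 'I_n -> H) : 0 <= tuple_norm2 x.
Proof. exact: sqrtr_ge0. Qed.

Lemma norm2_le_tuple n (x : 'I_n -> H) i : norm2 (x i) <= tuple_norm2 x.
Proof.
rewrite -[leLHS]ger0_norm ?norm2_ge0// -sqrtr_sqr ler_wsqrtr//.
rewrite (bigD1 i)//= lerDl sumr_ge0// => j _; exact: sqr_ge0.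
Qed.

Lemma tuple_norm2_le n (x : 'I_n -> H) (f : 'I_n -> R) :
  (forall i, norm2 (x i) <= f i) -> tuple_norm2 x <= Num.sqrt (\sum_i f i ^+ 2).
Proof.
move=> xf; apply: ler_wsqrtr; apply: ler_sum => i _.
by rewrite ler_pXn2r ?nnegrE ?norm2_ge0// (le_trans _ (xf i)) ?norm2_ge0.
Qed.

Lemma tuple_norm2Z n (c : R) (x : 'I_n -> H) : 0 <= c ->
  tuple_norm2 (fun i => c%:C *: x i) <= c * tuple_norm2 x.
Proof.
move=> c0; apply: le_trans (tuple_norm2_le (fun i => norm2_scale_real (x i) c0)) _.
under eq_bigr do rewrite exprMn.
by rewrite -mulr_sumr sqrtrM ?sqr_ge0// sqrtr_sqr ger0_norm.
Qed.

Definition opmx_apply n (T : 'M[bop R I]_n) (x : 'I_n -> H) : 'I_n -> H :=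
  fun i => \sum_j T i j (x j).

(** The supremum defining [opmx_norm T] is a default value unless the set is
    bounded. *)
Lemma opmx_apply_bounded n (T : 'M[bop R I]_n) :
  exists M, forall x, tuple_norm2 x <= 1 -> tuple_norm2 (opmx_apply T x) <= M.
Proof.
suff /choice[M MP] i : exists M, forall x : 'I_n -> H, tuple_norm2 x <= 1 ->
    norm2 (opmx_apply T x i) <= M.
  by eexists => x x1; apply: tuple_norm2_le => i; exact: MP x1.
rewrite /opmx_apply; elim: (index_enum _) => [|j l [M MP]].
  by exists 0 => x _; rewrite big_nil norm20.
have [N N0 TN] := bop_bounded (T i j).
exists (2 * N + 2 * M) => x x1; rewrite big_cons.
apply: le_trans (norm2D _ _) _; apply: lerD; rewrite ler_wpM2l//; last exact: MP.
apply: le_trans (TN _) _; rewrite ler_piMr//.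
exact: le_trans (norm2_le_tuple _ _) x1.
Qed.

Lemma opmx_norm_bound n (T : 'M[bop R I]_n) x :
  tuple_norm2 (opmx_apply T x) <= opmx_norm T * tuple_norm2 x.
Proof.
have [M MP] := opmx_apply_bounded T.
apply: (@sup_ball_bound _ (fun x => tuple_norm2 (opmx_apply T x))
  (fun x => tuple_norm2 x) M) => //.
- by move=> y; exact: tuple_norm2_ge0.
- by move=> y; exact: tuple_norm2_ge0.
- move=> c y c0; apply: le_trans (tuple_norm2Z _ c0).
  rewrite le_eqVlt; apply/orP; left; apply/eqP; congr tuple_norm2.
  apply/funext => i; rewrite /opmx_apply scaler_sumr; apply: eq_bigr => j _.
  by rewrite -bopZ.
- by move=> c y c0; exact: tuple_norm2Z.
Qed.

Lemma opmx_norm_ge0 n (T : 'M[bop R I]_n) : 0 <= opmx_norm T.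
Proof.
have [M MP] := opmx_apply_bounded T.
have z1 : tuple_norm2 (fun _ : 'I_n => 0 : H) <= 1.
  by rewrite /tuple_norm2 big1 ?sqrtr0// => i _; rewrite norm20 expr0n.
apply: le_trans (tuple_norm2_ge0 (opmx_apply T (fun=> 0))) _.
apply: ub_le_sup; last by exists (fun=> 0).
by exists M => _ [x x1 <-]; exact: MP.
Qed.

Lemma opmx_norm_le n (T : 'M[bop R I]_n) (N : R) : 0 <= N ->
  (forall x, tuple_norm2 (opmx_apply T x) <= N * tuple_norm2 x) ->
  opmx_norm T <= N.
Proof.
move=> N0 TN; apply: ge_sup => [|_ [x x1 <-]].
  exists (tuple_norm2 (opmx_apply T (fun=> 0))); exists (fun=> 0) => //=.
  by rewrite /tuple_norm2 big1 ?sqrtr0// => i _; rewrite norm20 expr0n.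
by apply: le_trans (TN x) _; rewrite ler_piMr.
Qed.

End OperatorNorms.

(** * Complete contractivity of compressions *)

Section CompressionMap.
Context {R : realType} {X A : choiceType}.
Local Notation H := (ell2 R X).
Variables (r : X -> option (A * X)) (s : A * X -> option X).
Hypothesis r_inj : partial_injection r.
Hypothesis s_inj : partial_injection s.

Lemma compress_fun_summable (T : bop R X) :
  exists2 M : R, 0 <= M &
    forall x : H, (sqsum (compress_fun r s_inj T x) <= M%:E * sqsum x)%E.
Proof.
have [M M0 TM] := bop_bounded T; exists (M ^+ 2) => [|x]; first exact: sqr_ge0.
have := @compress_bound _ _ _ r s r_inj s_inj 1 (fun _ _ => T) (M ^+ 2)
  (fun=> x) (sqr_ge0 _).
rewrite !big_ord1; under [X in sqsum X]eq_fun do rewrite big_ord1.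
apply=> y; rewrite !big_ord1 !sqsumE -EFinM lee_fin -exprMn.
by rewrite ler_pXn2r ?nnegrE ?mulr_ge0 ?norm2_ge0.
Qed.

Lemma compress_fun_subproof (T : bop R X) (x : H) :
  compress_fun r s_inj T x \in @square_summable R X.
Proof.
have [M M0 TM] := compress_fun_summable T.
rewrite unfold_in; apply: le_lt_trans (TM x) _.
by rewrite lte_mul_pinfty ?lee_fin//; exact: (ell2P x).
Qed.

Lemma compress_subproof (T : bop R X) :
  (fun x => Ell2 (compress_fun_subproof T x)) \in @bounded_linear R X.
Proof.
apply/asboolP; split=> [c x y|].
  apply: ell2_eqP => b.
  rewrite -[RHS]/(c *: compress_fun r s_inj T x b + compress_fun r s_inj T y b).
  rewrite /= /compress_fun; case: (r b) => [p|]; last by rewrite scaler0 addr0.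
  by rewrite sliceP bop_linear.
have [M M0 TM] := compress_fun_summable T.
exists (Num.sqrt M) => x; rewrite -(@ler_pXn2r _ 2) ?nnegrE ?mulr_ge0 ?sqrtr_ge0 ?norm2_ge0//.
rewrite exprMn (sqr_sqrtr M0); have := TM x.
by rewrite -[X in sqsum X]/(ell2_val (Ell2 (compress_fun_subproof T x)))
  !sqsumE -EFinM lee_fin.
Qed.

Definition compress (T : bop R X) : bop R X := Bop (compress_subproof T).

Lemma compressE (T : bop R X) x b : compress T x b =
  if r b is Some p then T (slice s_inj p.1 x) p.2 else 0.
Proof. by []. Qed.

Lemma compress_is_linear : linear compress.
Proof.
move=> c S T; apply: val_inj; apply/funext => x; apply: ell2_eqP => b.
rewrite -[RHS]/(c *: compress S x b + compress T x b) !compressE.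
by case: (r b) => [p|]//; rewrite scaler0 addr0.
Qed.

HB.instance Definition _ :=
  GRing.isLinear.Build R[i] (bop R X) (bop R X) _ compress compress_is_linear.

(** Compressing every entry of a matrix compresses the whole matrix, and
    [compress_bound] holds for all sizes with the same constant. *)
Lemma compress_cc : completely_contractive compress.
Proof.
move=> n T; have N0 := opmx_norm_ge0 T.
apply: opmx_norm_le => // x.
have bound y : (\sum_i sqsum ((\sum_j T i j (y j))%R : H) <=
    (opmx_norm T ^+ 2)%:E * \sum_j sqsum (y j))%E.
  rewrite (sum_sqsumE (opmx_apply T y)) sum_sqsumE -EFinM lee_fin -exprMn.
  by rewrite ler_pXn2r ?nnegrE ?mulr_ge0 ?tuple_norm2_ge0// opmx_norm_bound.
have := compress_bound (T := fun i j => bop_val (T i j)) r_inj s_inj x (sqr_ge0 _) bound.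
have -> : (\sum_i sqsum (fun b => (\sum_j compress_fun r s_inj (T i j) (x j) b)%R)
    = \sum_i sqsum (opmx_apply (map_mx compress T) x i))%E.
  apply: eq_bigr => i _; congr sqsum; apply/funext => b.
  by rewrite /opmx_apply ell2_sumE; apply: eq_bigr => j _; rewrite mxE.
rewrite (sum_sqsumE (opmx_apply _ x)) sum_sqsumE -EFinM lee_fin -exprMn.
by rewrite ler_pXn2r ?nnegrE ?mulr_ge0 ?tuple_norm2_ge0.
Qed.

End CompressionMap.

(** * Estimates for the inner product *)

Section WeakTopology.
Context {R : realType} {X : choiceType}.
Local Notation H := (ell2 R X).
Implicit Types (x y u : H) (T S : bop R X) (V : set (bop R X)).

Lemma norm_sqmod (z : R[i]) : `|z| = (Num.sqrt (sqmod z))%:C.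
Proof. by case: z => a b; rewrite normc_def. Qed.

Lemma rsum_bound (a f : X -> R) (B : R) : (forall i, `|a i| <= f i) ->
  (\esum_(i in [set: X]) (f i)%:E <= B%:E)%E -> `|rsum a| <= B.
Proof.
move=> af fB.
suff part (p : X -> R) : (forall i, 0 <= p i <= `|a i|) ->
    0 <= fine (\esum_(i in [set: X]) (p i)%:E) <= B.
  have /andP[p0 pB] : 0 <= fine (\esum_(i in [set: X]) (a^\+ i)%:E) <= B.
    by apply: part => i; rewrite /funrpos le_max lexx orbT/= ge_max ler_norm normr_ge0.
  have /andP[q0 qB] : 0 <= fine (\esum_(i in [set: X]) (a^\- i)%:E) <= B.
    by apply: part => i; rewrite /funrneg le_max lexx orbT/= ge_max -normrN ler_norm normr_ge0.
  by rewrite /rsum ler_norml; apply/andP; split; lra.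
move=> pP; have p0 : (0 <= \esum_(i in [set: X]) (p i)%:E)%E.
  by apply: esum_ge0 => i _; rewrite lee_fin; case/andP: (pP i).
have pB : (\esum_(i in [set: X]) (p i)%:E <= B%:E)%E.
  apply: le_trans fB; apply: le_esum => i _; rewrite lee_fin.
  by case/andP: (pP i) => _ /le_trans; apply.
rewrite fine_ge0//= -lee_fin fineK// ge0_fin_numE//.
exact: le_lt_trans pB (ltry _).
Qed.

(** A substitute for the Cauchy-Schwarz inequality: with a free parameter t it
    follows from the termwise inequality 2ab <= t a^2 + b^2 / t, which bounds
    the positive and negative parts in [rsum] separately. *)
Lemma inner_bound (t : R) x y : 0 < t ->
  Num.sqrt (sqmod (inner x y)) <= 2 * (t * norm2 x ^+ 2 + t^-1 * norm2 y ^+ 2).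
Proof.
move=> t0; set B := _ + _.
have B0 : 0 <= B by rewrite addr_ge0// mulr_ge0 ?sqr_ge0 ?invr_ge0 ?ltW.
have xyB : (\esum_(i in [set: X]) (t * sqmod (x i) + t^-1 * sqmod (y i))%:E <= B%:E)%E.
  under eq_esum do rewrite EFinD !EFinM.
  rewrite esumD; try by move=> i _; rewrite -EFinM lee_fin mulr_ge0 ?sqmod_ge0 ?invr_ge0 ?ltW.
  have le1 (c : R) (z : H) : 0 <= c ->
      (\esum_(i in [set: X]) (c%:E * (sqmod (z i))%:E) <= (c * norm2 z ^+ 2)%:E)%E.
    move=> c0; rewrite EFinM -sqsumE; apply: esumZ_le => // i.
    by rewrite lee_fin sqmod_ge0.
  by rewrite EFinD; apply: leeD; apply: le1; rewrite ?invr_ge0 ltW.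
have amgm (a b : R) : 2 * (a * b) <= t * a ^+ 2 + t^-1 * b ^+ 2.
  rewrite -subr_ge0.
  have -> : t * a ^+ 2 + t^-1 * b ^+ 2 - 2 * (a * b) = t^-1 * (t * a - b) ^+ 2.
    by field; rewrite gt_eqF.
  by rewrite mulr_ge0 ?sqr_ge0// invr_ge0 ltW.
have amgmN (a b : R) : - (2 * (a * b)) <= t * a ^+ 2 + t^-1 * b ^+ 2.
  by have := amgm (- a) b; rewrite sqrrN mulNr mulrN.
have Re_le : `|complex.Re (inner x y)| <= B.
  apply: rsum_bound xyB => i; rewrite /sqmod; case: (x i) (y i) => a b [c d] /=.
  have := amgm a c; have := amgm b d; have := amgmN a c; have := amgmN b d.
  rewrite ler_norml => *; apply/andP; split; lra.
have Im_le : `|complex.Im (inner x y)| <= B.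
  apply: rsum_bound xyB => i; rewrite /sqmod; case: (x i) (y i) => a b [c d] /=.
  have := amgm a d; have := amgm b c; have := amgmN a d; have := amgmN b c.
  rewrite ler_norml => *; apply/andP; split; lra.
have B2 : 0 <= 2 * B by rewrite mulr_ge0.
rewrite -[leRHS]ger0_norm// -sqrtr_sqr ler_wsqrtr// /sqmod.
move: Re_le Im_le; rewrite !ler_norml => /andP[r1 r2] /andP[i1 i2].
nra.
Qed.

Lemma inner_small y (e : R) : 0 < e -> exists2 d : R, 0 < d &
  forall x, norm2 x < d -> `|inner x y| < e%:C.
Proof.
move=> e0; pose c := norm2 y ^+ 2; have c0 : 0 <= c by exact: sqr_ge0.
(* This t makes the second term of [inner_bound] at most e / 8; the radius then
   does the same for the first term. *)
pose t := 8 * (c + 1) / e.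
have c1 : 0 < c + 1 by rewrite ltr_wpDl.
have t0 : 0 < t by rewrite divr_gt0 ?mulr_gt0.
have et0 : 0 < e / (8 * t) by apply: divr_gt0 => //; apply: mulr_gt0.
exists (Num.sqrt (e / (8 * t))); first by rewrite sqrtr_gt0.
move=> x xd; rewrite norm_sqmod ltcR; apply: le_lt_trans (inner_bound x y t0) _.
have /(ler_wpM2l (ltW t0)) : norm2 x ^+ 2 <= e / (8 * t).
  rewrite -[leRHS]sqr_sqrtr ?(ltW et0)//.
  by rewrite ler_pXn2r ?nnegrE ?norm2_ge0 ?sqrtr_ge0// ltW.
have -> : t * (e / (8 * t)) = e / 8 by field; rewrite gt_eqF.
have : t^-1 * norm2 y ^+ 2 <= e / 8.
  have -> : t^-1 * norm2 y ^+ 2 = e / 8 * (c / (c + 1)).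
    by rewrite -/c /t; field; rewrite !gt_eqF.
  rewrite ler_piMr ?divr_ge0 ?(ltW e0)// ler_pdivrMr// mul1r; lra.
lra.
Qed.

Lemma inner_delta x b : inner x (delta b) = x b.
Proof.
have E (a : X -> R) : (forall i, i != b -> a i = 0) -> rsum a = a b.
  move=> a0.
  have one (p : X -> R) : (forall i, 0 <= p i) -> (forall i, i != b -> p i = 0) ->
      fine (\esum_(i in [set: X]) (p i)%:E) = p b.
    move=> p0 pb; rewrite -[RHS]/(fine (p b)%:E); congr fine.
    rewrite -[RHS](@esum_set1 _ _ b (fun i => (p i)%:E)) ?lee_fin//.
    rewrite [RHS]esum_mkcond; apply: eq_esum => i _; case: ifPn => //.
    by rewrite notin_setE => /eqP/pb->.
  rewrite /rsum !one => [| i | i ib | i | i ib].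
  - have [ab|/ltW ab] := leP 0 (a b).
      by rewrite [a^\- b]max_r ?oppr_le0// [a^\+ b]max_l// subr0.
    by rewrite [a^\- b]max_l ?oppr_ge0// [a^\+ b]max_r// sub0r opprK.
  - by rewrite /funrneg le_max lexx orbT.
  - by rewrite /funrneg a0// oppr0 maxxx.
  - by rewrite /funrpos le_max lexx orbT.
  - by rewrite /funrpos a0// maxxx.
apply/eqP; rewrite eq_complex /inner !E /=; try by move=> i /negbTE ib;
  rewrite ib rmorph0 mulr0.
by rewrite eqxx rmorph1 mulr1 !eqxx.
Qed.

Lemma eval_bound x b : `|x b| <= (norm2 x)%:C.
Proof.
rewrite norm_sqmod lecR -[leRHS]ger0_norm ?norm2_ge0// -sqrtr_sqr ler_wsqrtr//.
rewrite -lee_fin -sqsumE.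
rewrite -[leLHS](@esum_set1 _ _ b (fun b => (sqmod (x b))%:E)) ?lee_fin ?sqmod_ge0//.
rewrite esum_mkcond; apply: le_esum => i _.
by case: ifP => // _; rewrite lee_fin sqmod_ge0.
Qed.

End WeakTopology.

(** * Closures and linear spans *)

Section Closures.
Context {R : realType} {X : choiceType}.
Local Notation H := (ell2 R X).
Implicit Types (x y u : H) (T S : bop R X) (V : set (bop R X)).

Lemma bopB_apply T S x b : (T - S) x b = T x b - S x b.
Proof. by []. Qed.

(** The equation between two fixed matrix coefficients is a closed condition on
    the operator. *)
Lemma eq_coef_of_approx T x b x' b' :
  (forall e : R, 0 < e -> exists S, [/\ S x b = S x' b',
     `|(T - S) x b| < e%:C & `|(T - S) x' b'| < e%:C]) ->
  T x b = T x' b'.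
Proof.
move=> TS; apply/eqP; rewrite -subr_eq0; apply/eqP.
set z := _ - _; apply/eqP/negPn/negP => z0.
pose m := Num.sqrt (sqmod z).
have zm : `|z| = m%:C by exact: norm_sqmod.
have m0 : 0 < m by rewrite -ltcR -zm normr_gt0.
have [|S [SE h1 h2]] := TS (m / 2); first by rewrite divr_gt0.
have zE : z = (T - S) x b - (T - S) x' b'.
  by rewrite !bopB_apply SE /z opprB addrA subrK.
have := ler_normB ((T - S) x b) ((T - S) x' b').
rewrite -zE zm => /le_lt_trans/(_ (ltrD h1 h2)).
by rewrite -rmorphD/= ltcR -splitr ltxx.
Qed.

Lemma eq_coef_norm_closure V x b x' b' :
  (forall S, V S -> S x b = S x' b') ->
  forall T, norm_closure V T -> T x b = T x' b'.
Proof.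
move=> VE T TV; apply: eq_coef_of_approx => e e0.
pose c := norm2 x + norm2 x' + 1.
have x0 := norm2_ge0 x; have x'0 := norm2_ge0 x'.
have c0 : 0 < c by rewrite /c; lra.
have [S VS TS] := TV (e / c) (divr_gt0 e0 c0); exists S; split; first exact: VE.
- apply: le_lt_trans (eval_bound _ _) _; rewrite ltcR.
  apply: le_lt_trans (opnorm_bound _ _) _.
  apply: (@le_lt_trans _ _ (e / c * norm2 x)); first by rewrite ler_wpM2r// ltW.
  by rewrite mulrAC ltr_pdivrMr// ltr_pM2l// /c; lra.
- apply: le_lt_trans (eval_bound _ _) _; rewrite ltcR.
  apply: le_lt_trans (opnorm_bound _ _) _.
  apply: (@le_lt_trans _ _ (e / c * norm2 x')); first by rewrite ler_wpM2r// ltW.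
  by rewrite mulrAC ltr_pdivrMr// ltr_pM2l// /c; lra.
Qed.

(** By [inner_delta] both coefficients are weakly continuous, so one weak
    neighbourhood, given by two pairs of vectors, controls them. *)
Lemma eq_coef_weak_closure V x b x' b' :
  (forall S, V S -> S x b = S x' b') ->
  forall T, weak_closure V T -> T x b = T x' b'.
Proof.
move=> VE T TV; apply: eq_coef_of_approx => e e0.
have [S VS TS] := TV 2 (fun k => if k == ord0 then x else x')
  (fun k => delta (if k == ord0 then b else b')) e e0.
exists S; split; first exact: VE.
- by have := TS ord0; rewrite inner_delta.
- by have := TS ord_max; rewrite inner_delta.
Qed.

Lemma opnorm0 : opnorm (0 : bop R X) = 0.
Proof.
apply/eqP; rewrite eq_le; apply/andP; split.
  apply: ge_sup => [|_ [x _ <-]]; last by rewrite norm20.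
  by exists (norm2 (0 : H)); exists 0 => //=; rewrite norm20.
apply: ub_le_sup; first by exists 0 => _ [x _ <-]; rewrite norm20.
by exists 0 => //=; rewrite norm20.
Qed.

Lemma sub_norm_closure V : V `<=` norm_closure V.
Proof. by move=> T VT e e0; exists T; rewrite ?subrr ?opnorm0. Qed.

Lemma weak_closure_of_strong V T :
  (forall n (x : 'I_n -> H) (e : R), 0 < e ->
    exists2 S, V S & forall k, norm2 ((T - S) (x k)) < e) ->
  weak_closure V T.
Proof.
move=> TV n x y e e0.
have [d d0 dP] : exists2 d : R, 0 < d & forall u k, norm2 u < d -> `|inner u (y k)| < e%:C.
  pose d k := s2val (cid2 (inner_small (y k) e0)).
  exists (\big[Num.min/1]_k d k) => [|u k ud].
    by apply: lt_bigmin => // k _; rewrite /d; case: cid2.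
  have dk : norm2 u < d k by apply: lt_le_trans ud _; exact: bigmin_le.
  by move: dk; rewrite /d; case: cid2 => /= a _; apply.
have [S VS TS] := TV n x d d0; exists S => // k; exact: dP.
Qed.

Lemma linear_span0 V : linear_span V 0.
Proof.
by exists 0%N, (fun=> 0), (fun=> 0); split=> [[]|]//; rewrite big_ord0.
Qed.

Lemma linear_spanD V S T : linear_span V S -> linear_span V T -> linear_span V (S + T).
Proof.
move=> [m [c [A [VA ->]]]] [n [d [B [VB ->]]]].
pose glue U (f : 'I_m -> U) (g : 'I_n -> U) (k : 'I_(m + n)) :=
  match fintype.split k with inl i => f i | inr j => g j end.
exists (m + n)%N, (glue _ c d), (glue _ A B); split.
  by move=> k; rewrite /glue; case: (fintype.split k).
rewrite big_split_ord/=; congr (_ + _); apply: eq_bigr => i _.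
  by rewrite /glue (unsplitK (inl i)).
by rewrite /glue (unsplitK (inr i)).
Qed.

Lemma linear_spanZ V c S : linear_span V S -> linear_span V (c *: S).
Proof.
move=> [m [d [A [VA ->]]]]; exists m, (fun k => c * d k), A; split=> //.
by rewrite scaler_sumr; apply: eq_bigr => k _; rewrite scalerA.
Qed.

Lemma sub_linear_span V : V `<=` linear_span V.
Proof.
by move=> S VS; exists 1%N, (fun=> 1), (fun=> S); split; rewrite ?big_ord1 ?scale1r.
Qed.

Lemma linear_span_sum V {J : Type} (l : seq J) (P : pred J) (F : J -> bop R X) :
  (forall j, P j -> linear_span V (F j)) -> linear_span V (\sum_(j <- l | P j) F j).
Proof. by move=> VF; elim/big_ind: _ => //; [exact: linear_span0|exact: linear_spanD]. Qed.

(** The coordinate projection onto the span of the basis vectors selected by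
    [D] is the partial isometry of a partial identity map. *)
Definition keep (D : pred X) (i : X) : option X := if D i then Some i else None.

Lemma keep_inj D : partial_injection (keep D).
Proof. by move=> i j k; rewrite /keep; case: ifP => // _ [->]; case: ifP => // _ [->]. Qed.

Definition truncation (D : pred X) : bop R X := partial_isometry (@keep_inj D).

Lemma truncationE D x i : truncation D x i = if D i then x i else 0.
Proof. by rewrite /= /pullback /keep; case: (D i). Qed.

(** A finite set carrying all of the square sum but e^2 leaves a tail of norm
    less than e. *)
Lemma truncation_tail x (e : R) : 0 < e -> exists l : seq X, forall D : pred X,
  (forall i, i \in l -> D i) -> norm2 (x - truncation D x) < e.
Proof.
move=> e0; have e2 : 0 < e ^+ 2 by exact: exprn_gt0.
have fin : ereal_sup [set (\sum_(i \in A) (sqmod (x i))%:E)%E | A in fsets [set: X]]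
    \is a fin_num.
  by have := sqsumE x; rewrite /sqsum /esum => ->.
have [_ [F [finF _] <-]] := ub_ereal_sup_adherent e2 fin.
rewrite -/(esum _ _) -/(sqsum x) -esum_fset//; last first.
  by move=> i _; rewrite lee_fin sqmod_ge0.
move=> lt; have /finite_seqP[l Fl] := finF; exists l => D lD.
rewrite -(@ltr_pXn2r _ 2) ?nnegrE ?norm2_ge0 ?ltW// -lte_fin -sqsumE.
have split2 : (sqsum x = \esum_(i in F) (sqmod (x i))%:E +
    \esum_(i in ~` F) (sqmod (x i))%:E)%E.
  rewrite /sqsum (esumID F) ?setTI// => i _; rewrite lee_fin sqmod_ge0//.
apply: (@le_lt_trans _ _ (\esum_(i in ~` F) (sqmod (x i))%:E)%E).
  rewrite [leRHS]esum_mkcond; apply: le_esum => i _.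
  rewrite -[(x - _) i]/(x i - truncation D x i) truncationE.
  have [Fi|] := boolP (i \in ~` F).
    by case: (D i); rewrite ?subr0 ?subrr ?sqmod0 ?lee_fin ?sqmod_ge0.
  rewrite notin_setE Fl /= => /contrapT il.
  by rewrite lD// subrr sqmod0.
move: lt; rewrite split2.
have : (sqsum x \is a fin_num) by rewrite sqsumE.
rewrite split2 fin_numD => /andP[f1 f2].
move: f1 f2; case: (\esum_(i in F) _)%E => // a _; case: (\esum_(i in ~` F) _)%E => // b _.
by rewrite !lte_fin; lra.
Qed.

End Closures.

(** * Blocks of a subsemiheap *)

Section Blocks.
Implicit Types (S : set int) (i j k m : int).

Lemma int_max (P : int -> Prop) i m : P i -> (forall k, P k -> k <= m) ->
  exists2 k, P k & forall l, P l -> l <= k.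
Proof.
move=> Pi Pm; have [n] : exists n : nat, m - i <= n%:Z.
  by exists `|m - i|%N; lia.
elim: n i Pi => [|n IHn] i Pi lt_n.
  by exists i => // l /Pm; lia.
have [[l [Pl il]]|noP] := pselect (exists l, P l /\ i < l).
  by apply: IHn Pl _; lia.
by exists i => // l Pl; rewrite leNgt; apply/negP => il; apply: noP; exists l.
Qed.

Definition block_start S m i : Prop :=
  [/\ S i, i <= m & forall l, S l -> l <= m -> l <= i].

Lemma block_start_uniq S m i j : block_start S m i -> block_start S m j -> i = j.
Proof.
move=> [Si im mi] [Sj jm mj]; apply/eqP.
by rewrite eq_le mj// mi.
Qed.

Definition start S m : option int :=
  if pselect (exists i, block_start S m i) is left e then Some (projT1 (cid e)) else None.

Lemma startP S m i : start S m = Some i <-> block_start S m i.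
Proof.
rewrite /start; case: pselect => [e|ne]; last by split=> // mi; case: ne; exists i.
case: cid => j mj /=; split=> [[<-]//|mi].
by rewrite (block_start_uniq mj mi).
Qed.

Lemma start_exists S m i : S i -> i <= m -> exists2 k, start S m = Some k & i <= k.
Proof.
move=> Si im; have [k [Sk km] kP] := @int_max (fun l => S l /\ l <= m) i m
  (conj Si im) (fun l h => h.2).
exists k; last by apply: kP.
by apply/startP; split=> // l Sl lm; apply: kP.
Qed.

(** This is [int_max] for the reflected set. *)
Lemma next_exists S i l : S l -> i < l ->
  exists k, [/\ S k, i < k & forall l, S l -> i < l -> k <= l].
Proof.
move=> Sl il; have [||k [Sk ik] kP] := @int_max (fun l => S (- l) /\ i < - l) (- l) (- i).
- by rewrite opprK.
- by move=> k [_]; lia.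
exists (- k); split=> // l' Sl' il'; have := kP (- l'); rewrite opprK => /(_ _)/wrap[]//.
by lia.
Qed.

Variable K : set ebs.
Hypothesis hK : subsemiheap K.

Definition rows : set int := [set i | exists j, K (i, j)].
Definition cols : set int := [set j | exists i, K (i, j)].

(** a_ij a_pj^* a_ps = a_is. *)
Lemma semiheap_rect i j p s : K (i, j) -> K (p, j) -> K (p, s) -> K (i, s).
Proof.
move=> h1 h2 h3; have := hK h1 h2 h3; rewrite /ebs_mul /ebs_star /=.
by congr K; congr pair; lia.
Qed.

(** Multiplying a_ij on the left by the idempotent of l restricts its range to
    the integers from l on. *)
Lemma semiheap_shift_row i j l : K (i, j) -> rows l -> i <= l -> K (l, j + (l - i)).
Proof.
move=> h1 [p h2] il; have := hK h2 h2 h1; rewrite /ebs_mul /ebs_star /=.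
by congr K; congr pair; lia.
Qed.

(** The same on the right, with the domain restricted to the integers from l on. *)
Lemma semiheap_shift_col i j l : K (i, j) -> cols l -> j <= l -> K (i + (l - j), l).
Proof.
move=> h1 [p h2] jl; have := hK h1 h2 h2; rewrite /ebs_mul /ebs_star /=.
by congr K; congr pair; lia.
Qed.

(** The rectangle of a row and the rectangle of a column are both recorded by
    the set of columns of the rectangle, so that membership in K becomes an
    equality of labels. *)
Definition row_class i : set int := [set j | K (i, j)].
Definition col_class j : set int := [set l | exists i, K (i, j) /\ K (i, l)].

Lemma row_col_class i j : rows i -> cols j -> row_class i = col_class j <-> K (i, j).
Proof.
move=> [l il] [p pj]; split=> [ij|ij].
  have : col_class j j by exists p.
  by rewrite -ij.
apply/seteqP; split=> s; first by exists i.
by move=> [t [tj ts]]; exact: semiheap_rect ij tj ts.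
Qed.

(** A start of a block of columns between j and j + k would translate, by
    [semiheap_shift_col], to a start of a block of rows between i and i + k, and
    conversely. *)
Lemma same_block i j k : K (i, j) -> 0 <= k ->
  start rows (i + k) = Some i <-> start cols (j + k) = Some j.
Proof.
move=> ij k0; rewrite !startP; split=> -[hS hle hmax]; split.
- by exists i.
- by lia.
- move=> l cl ljk; rewrite leNgt; apply/negP => jl.
  have : i + (l - j) <= i by apply: hmax; [exists l; apply: semiheap_shift_col; rewrite ?ltW|lia].
  by lia.
- by exists j.
- by lia.
- move=> l rl lik; rewrite leNgt; apply/negP => il.
  have : j + (l - i) <= j by apply: hmax; [exists l; apply: semiheap_shift_row; rewrite ?ltW|lia].
  by lia.
Qed.

Lemma block_match i j m : start rows m = Some i ->
  K (i, j) <-> start cols (j + (m - i)) = Some j /\ row_class i = col_class j.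
Proof.
move=> /[dup] mi /startP[ri im _]; have mE : i + (m - i) = m by lia.
split=> [ij|[/startP[cj _ _] ij]]; last by apply/row_col_class.
split; last by apply/row_col_class => //; exists i.
by apply/(same_block ij); rewrite ?mE//; lia.
Qed.

(** A repetition of the matrix entries of T: the rectangle, the position in the
    block, and the second coordinate in l^2(Z x Z). *)
Definition copy_label : choiceType := (set int * int * int)%type.

(** Row [b] of P(T) is, in the repetition given by the label, the row of T at the
    start of the block of [b]; T is read where the second coordinate is 0. *)
Definition row_address (b : ebs) : option (copy_label * ebs) :=
  if start rows b.1 is Some i
  then Some ((row_class i, b.1 - i, b.2), (i, 0)) else None.

(** The columns are addressed in the opposite direction, since slices pull back
    from the repetitions.  The label fixes the rectangle of the column [j]; the
    condition on [start] says that the block of [j] reaches position [k]. *)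
Definition col_address (p : copy_label * ebs) : option ebs :=
  let: ((c, k, q), (j, z)) := p in
  if `[< [/\ z = 0, start cols (j + k) = Some j & c = col_class j] >]
  then Some (j + k, q) else None.

Lemma row_address_inj : partial_injection row_address.
Proof.
move=> [m q] [m' q'] p; rewrite /row_address /=.
case: (start rows m) => [i|//] [<-]; case: (start rows m') => [i'|//] [_ h <- ii].
by congr pair; lia.
Qed.

Lemma col_address_inj : partial_injection col_address.
Proof.
move=> [[[c k] q] [j z]] [[[c' k'] q'] [j' z']] b /=.
case: asboolP => // -[-> jk ->] [<-]; case: asboolP => // -[-> jk' ->] [kk ->].
have jj : j' = j by move: jk'; rewrite kk jk => -[].
by rewrite jj in kk *; congr (_, _, _, _); lia.
Qed.

End Blocks.

(** * The projection onto the ternary ring of a subsemiheap *)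

Lemma sum_supported_at {V : nmodType} {I : eqType} (l : seq I) i (F : I -> V) :
  uniq l -> (forall j, j != i -> F j = 0) ->
  \sum_(j <- l) F j = if i \in l then F i else 0.
Proof.
move=> ul F0; case: ifPn => il.
  by rewrite (bigD1_seq i)//= big1 ?addr0// => j /F0.
by rewrite big1_seq// => j /andP[_ jl]; apply: F0; apply: contraNneq il => <-.
Qed.

Section Expectation.
Variables (R : realType) (K : set ebs).
Hypothesis hK : subsemiheap K.
Implicit Types (i j k m q : int).
Local Notation H := (ell2 R ebs).

Definition block_compression : bop R ebs -> bop R ebs :=
  compress (@row_address_inj K) (@col_address_inj K).
HB.instance Definition _ := GRing.Linear.on block_compression.

Definition copy (x : H) i k q : H := slice (@col_address_inj K) (row_class K i, k, q) x.

Lemma block_compressionE (T : bop R ebs) x m q : block_compression T x (m, q) =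
  if start (rows K) m is Some i then T (copy x i (m - i) q) (i, 0) else 0.
Proof.
rewrite /block_compression compressE /row_address /=.
by case: (start (rows K) m).
Qed.

Lemma copyE x i m q j z : start (rows K) m = Some i ->
  copy x i (m - i) q (j, z) =
  if (z == 0) && `[< K (i, j) >] then x (j + (m - i), q) else 0.
Proof.
move=> mi; rewrite /copy /= /slice_fun /col_address.
case: asboolP => [[-> jm cl]|nK].
  by rewrite eqxx asboolT//; apply/(block_match hK j mi).
case: eqP => //= z0; case: asboolP => // /(block_match hK j mi)[jm cl].
by case: nK.
Qed.

Lemma lregE i j (x : H) m q :
  lreg R (i, j) x (m, q) = if i <= m then x (j + (m - i), q) else 0.
Proof. by rewrite /= /pullback lreg_backE /=; case: ifP. Qed.

(** If a = (i0, j0) and the row m >= i0 lies in the block of i, then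
    (i, j0 + (i - i0)) is in K, so m - i0 + j0 lies at the same position in the
    block of j0 + (i - i0): reading at the starts of blocks loses nothing. *)
Lemma block_compression_lreg a : K a -> block_compression (lreg R a) = lreg R a.
Proof.
case: a => i0 j0 Ka; apply: val_inj; apply/funext => x; apply: ell2_eqP => -[m q].
rewrite block_compressionE [RHS]lregE.
have r0 : rows K i0 by exists j0.
case: (leP i0 m) => im; last first.
  case mi: (start (rows K) m) => [i|//]; rewrite lregE ifF//.
  by have /startP[_ ? _] := mi; apply/negP; lia.
have [i mi ii] := start_exists r0 im; rewrite mi lregE ii.
rewrite (copyE x q (j0 + (i - i0)) 0 mi) eqxx asboolT; first by congr (x (_, _)); lia.
by apply: semiheap_shift_row => //; have /startP[] := mi.
Qed.

(** The operator W is w_ij (x) 1. *)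
Lemma block_unit_in_span i j : K (i, j) -> exists2 W : bop R ebs, linear_span (lreg R @` K) W &
  forall x m q, W x (m, q) =
    if start (rows K) m == Some i then x (j + (m - i), q) else 0.
Proof.
move=> ij; have ri : rows K i by exists j.
have [[l [rl il]]|no_next] := pselect (exists l, rows K l /\ i < l); last first.
  (* The block of i is infinite. *)
  exists (lreg R (i, j)); first by apply: sub_linear_span; exists (i, j).
  move=> x m q; rewrite lregE; case: (leP i m) => im.
    have [i' mi' ii'] := start_exists ri im; rewrite mi'.
    case: eqP => // ne; case: ne; congr Some; apply/eqP; rewrite eq_le ii' andbT leNgt.
    apply/negP => lt; apply: no_next; exists i'; split=> //.
    by have /startP[] := mi'.
  by case: eqP => // /startP[_ ? _]; lia.
(* The block of i ends where the block of the next row n starts. *)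
have [n [rn i_n nP]] := next_exists rl il.
exists (lreg R (i, j) - lreg R (n, j + (n - i))).
  rewrite -scaleN1r; apply: linear_spanD.
    by apply: sub_linear_span; exists (i, j).
  apply: linear_spanZ; apply: sub_linear_span; exists (n, j + (n - i)) => //.
  by apply: semiheap_shift_row => //; exact: ltW.
move=> x m q; rewrite bopB_apply !lregE.
have -> : j + (n - i) + (m - n) = j + (m - i) by lia.
case: (leP i m) => im.
  have [i' mi' ii'] := start_exists ri im; rewrite mi'.
  have /startP[ri' im' mP] := mi'.
  case: (leP n m) => nm.
    rewrite subrr ifF//; apply/eqP => -[ie]; have := mP n rn nm; lia.
  rewrite subr0; case: eqP => // ne; case: ne; congr Some.
  apply/eqP; rewrite eq_le ii' andbT leNgt; apply/negP => lt.
  by have := nP i' ri' lt; lia.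
rewrite ifF ?subr0; last by apply/negP; lia.
by case: eqP => // /startP[_ ? _]; lia.
Qed.

(** The union of the blocks with start in L.  The integers in no block are added
    to it: P(T) has zero rows and columns there, and every finite subset of E is
    then inside a window with finite L. *)
Definition row_window (L : seq int) (b : ebs) : bool :=
  if start (rows K) b.1 is Some i then i \in L else true.

Definition col_window (L : seq int) (b : ebs) : bool :=
  if start (cols K) b.1 is Some i then i \in L else true.

Lemma copy_window (L : seq int) x i m q : uniq L -> start (rows K) m = Some i ->
  copy (truncation (col_window L) x) i (m - i) q =
  \sum_(j <- L) (if `[< K (i, j) >] then x (j + (m - i), q) else 0) *: delta (j, 0).
Proof.
move=> uL mi; apply: ell2_eqP => -[j z]; rewrite copyE// truncationE ell2_sumE.
have E l : ((if `[< K (i, l) >] then x (l + (m - i), q) else 0) *: delta (l, 0 : int) : H) (j, z)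
    = if (j == l) && ((z == 0) && `[< K (i, j) >]) then x (j + (m - i), q) else 0.
  rewrite -[LHS]/((if `[< K (i, l) >] then x (l + (m - i), q) else 0) *
    ((j, z) == (l, 0))%:R) xpair_eqE.
  case: (eqVneq j l) => [->|_]/=; last by rewrite mulr0.
  by case: (z == 0) => /=; rewrite ?mulr1 ?mulr0//; case: asboolP.
under eq_bigr do rewrite E.
rewrite (sum_supported_at (i := j))// => [|l lj]; last by rewrite eq_sym (negbTE lj).
rewrite eqxx /=; case: (boolP ((z == 0) && _)) => [/andP[_ /asboolP ij]|_]; last by case: ifP.
by have /(block_match hK j mi)[jE _] := ij; rewrite /col_window jE.
Qed.

(** Seen through the windows, P(T) is the sum of the
    T_((i,0),(j,0)) w_ij (x) 1 with (i, j) in K, i in Lr and j in Lc. *)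
Lemma block_compression_window (Lr Lc : seq int) (T : bop R ebs) :
  uniq Lr -> uniq Lc ->
  exists2 S, linear_span (lreg R @` K) S & forall x,
    S x = truncation (row_window Lr) (block_compression T (truncation (col_window Lc) x)).
Proof.
move=> uLr uLc.
have /choice[W WP] (p : ebs) : exists W : bop R ebs, K p -> linear_span (lreg R @` K) W /\
  forall x m q, W x (m, q) =
    if start (rows K) m == Some p.1 then x (p.2 + (m - p.1), q) else 0.
  case: p => i j; have [/block_unit_in_span[W WV WE]|nK] := pselect (K (i, j)); last by exists 0.
  by exists W.
exists (\sum_(i <- Lr) \sum_(j <- Lc)
   (if `[< K (i, j) >] then T (delta (j, 0)) (i, 0) else 0) *:
   (if `[< K (i, j) >] then W (i, j) else 0)).
  apply: linear_span_sum => i _; apply: linear_span_sum => j _; apply: linear_spanZ.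
  by case: asboolP => [/WP[]|_] //; exact: linear_span0.
move=> x; apply: ell2_eqP => -[m q].
rewrite truncationE block_compressionE /row_window /= bop_sumE ell2_sumE.
have E i : (\sum_(j <- Lc)
   (if `[< K (i, j) >] then T (delta (j, 0)) (i, 0) else 0) *:
   (if `[< K (i, j) >] then W (i, j) else 0)) x (m, q) =
   if start (rows K) m == Some i then
     \sum_(j <- Lc) (if `[< K (i, j) >] then x (j + (m - i), q) else 0) * T (delta (j, 0)) (i, 0)
   else 0.
  rewrite bop_sumE ell2_sumE.
  case: ifP => mi; [apply: eq_bigr|apply: big1] => j _.
    case: asboolP => ij; last by rewrite scale0r mul0r.
    rewrite -[LHS]/(T (delta (j, 0)) (i, 0) * W (i, j) x (m, q)).
    by have [_ ->] := WP _ ij; rewrite mi mulrC.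
  case: asboolP => ij; last by rewrite scale0r.
  rewrite -[LHS]/(T (delta (j, 0)) (i, 0) * W (i, j) x (m, q)).
  by have [_ ->] := WP _ ij; rewrite mi mulr0.
under eq_bigr do rewrite E.
case mi: (start (rows K) m) => [i|]; last by rewrite big1.
rewrite (sum_supported_at (i := i))// => [|l li]; last first.
  by case: eqP => // -[il]; rewrite il eqxx in li.
rewrite eqxx copy_window// bop_sum ell2_sumE; case: ifP => // _.
by apply: eq_bigr => j _; rewrite bopZ.
Qed.

Lemma truncation_contractive (D : pred ebs) (x : H) : norm2 (truncation D x) <= norm2 x.
Proof. by apply: norm2_le; exact: sqsum_pullback (@keep_inj _ D) _. Qed.

(** With D and D' the truncations to the windows, P(T) x - D P(T) D' x is
    (1 - D) P(T) x + D P(T) (1 - D') x, which is controlled by the tails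
    (1 - D) P(T) x and (1 - D') x of square summable vectors. *)
Lemma block_compression_approx (T : bop R ebs) n (x : 'I_n -> H) (e : R) : 0 < e ->
  exists2 S, linear_span (lreg R @` K) S &
    forall h, norm2 ((block_compression T - S) (x h)) < e.
Proof.
move=> e0; set PT := block_compression T; have [M M0 TM] := bop_bounded PT.
have M1 : 0 < M + 1 by rewrite ltr_wpDl.
have e4 : 0 < e / 4 by rewrite divr_gt0.
have e4M : 0 < e / 4 / (M + 1) by rewrite divr_gt0.
have [l lP] := choice (fun h => truncation_tail (PT (x h)) e4).
have [l' l'P] := choice (fun h => truncation_tail (x h) e4M).
pose Lr := undup (pmap (fun b : ebs => start (rows K) b.1) (flatten [seq l h | h <- enum 'I_n])).
pose Lc := undup (pmap (fun b : ebs => start (cols K) b.1) (flatten [seq l' h | h <- enum 'I_n])).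
have [S SV SE] := block_compression_window T (undup_uniq _ : uniq Lr) (undup_uniq _ : uniq Lc).
exists S => // h.
have yD : norm2 (PT (x h) - truncation (row_window Lr) (PT (x h))) < e / 4.
  apply: lP => b bl; rewrite /row_window; case bi: (start _ _) => [i|//].
  rewrite mem_undup mem_pmap; apply/mapP; exists b => //.
  by apply/flatten_mapP; exists h; rewrite ?mem_enum.
have xD : norm2 (x h - truncation (col_window Lc) (x h)) < e / 4 / (M + 1).
  apply: l'P => b bl; rewrite /col_window; case bi: (start _ _) => [i|//].
  rewrite mem_undup mem_pmap; apply/mapP; exists b => //.
  by apply/flatten_mapP; exists h; rewrite ?mem_enum.
set D := row_window Lr in yD *; set D' := col_window Lc in xD SE *.
set z := x h - truncation D' (x h) in xD.
have -> : (PT - S) (x h) = (PT (x h) - truncation D (PT (x h))) + truncation D (PT z).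
  rewrite -[LHS]/(PT (x h) - S (x h)) SE -/PT -addrA; congr (_ + _).
  by rewrite /z !bopB addrA addNr sub0r.
apply: le_lt_trans (norm2D _ _) _.
have : norm2 (truncation D (PT z)) <= M * norm2 z := le_trans (truncation_contractive _ _) (TM z).
have : M * norm2 z <= e / 4.
  apply: le_trans (ler_wpM2l M0 (ltW xD)) _.
  by rewrite mulrCA -[leRHS]mulr1 ler_wpM2l ?(ltW e4)// ler_pdivrMr// mul1r lerDl.
lra.
Qed.

End Expectation.

Theorem corollary4p3 (R : realType) (K : set ebs) (hK : subsemiheap K) :
  injective_operator_space (VNTRO R K).
Proof.
have fixed T : VNTRO R K T -> block_compression K T = T.
  move=> TV; apply: val_inj; apply/funext => x; apply: ell2_eqP => -[m q].
  have fix_span S : linear_span (lreg R @` K) S -> block_compression K S = S.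
    move=> [n [c [A [AK ->]]]]; rewrite linear_sum; apply: eq_bigr => k _.
    by rewrite linearZ; have [a Ka <-] := AK k; rewrite /= block_compression_lreg.
  have [x' [b' coef]] : exists x' b', forall S : bop R ebs,
      block_compression K S x (m, q) = S x' b'.
    case mi: (start (rows K) m) => [i|].
      by exists (copy K x i (m - i) q), (i, 0) => S; rewrite block_compressionE mi.
    by exists 0, (0, 0) => S; rewrite block_compressionE mi bop0.
  rewrite coef; apply/esym; apply: eq_coef_weak_closure TV => S.
  by apply: eq_coef_norm_closure => {}S /fix_span SE; rewrite -coef SE.
have in_range T : VNTRO R K (block_compression K T).
  have PT := weak_closure_of_strong (@block_compression_approx R K hK T).
  move=> n x y e e0; have [S SV ST] := PT n x y e e0.
  by exists S; [exact: sub_norm_closure SV|exact: ST].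
exists (block_compression K); split.
- by move=> T; exact: fixed (in_range T).
- exact: compress_cc.
- apply/seteqP; split=> [_ [T _ <-]|T TV]; first exact: in_range.
  by exists T; [|exact: fixed].
Qed.
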